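(* Among the eight standard parabolic subalgebras $\mathfrak{p}_\Pi$ ($\Pi\subseteq\Delta(so(7,\mathbb{C}))=\{\varepsilon_1-\varepsilon_2,\varepsilon_2-\varepsilon_3,\varepsilon_3\}$) of $so(7,\mathbb{C})$, exactly four are $\mathfrak{g}_2$-compatible: $\mathfrak{b}_{so(7,\mathbb{C})}=\mathfrak{p}_\emptyset$, $\mathfrak{p}_{\{\varepsilon_2-\varepsilon_3\}}$, $\mathfrak{p}_{\{\varepsilon_1-\varepsilon_2,\varepsilon_3\}}$ and $\mathfrak{p}_{\Delta(so(7,\mathbb{C}))}=so(7,\mathbb{C})$.
   Context: Setting for $so(7,\mathbb{C})$: it is realized as the Lie algebra of $7\times7$ complex matrices skew-adjoint relative to the quadratic form $2(z_1z_4+z_2z_5+z_3z_6)+z_7^2$. Its Cartan subalgebra $\mathfrak{h}_{so(7,\mathbb{C})}$ has basis $H_i=E_{ii}-E_{i+3,i+3}$ ($i=1,2,3$), with dual basis $\varepsilon_1,\varepsilon_2,\varepsilon_3$. Roots: $\pm\varepsilon_i\pm\varepsilon_j$ ($i<j$) and $\pm\varepsilon_k$; simple roots: $\varepsilon_1-\varepsilon_2,\varepsilon_2-\varepsilon_3,\varepsilon_3$. Embedding of $\mathfrak{g}_2$: $\mathfrak{g}_2\subset so(7,\mathbb{C})$ has Cartan subalgebra $\mathfrak{h}_{\mathfrak{g}_2}\subset\mathfrak{h}_{so(7,\mathbb{C})}$ spanned by $H_{\alpha_1}=H_1-H_2+2H_3$ and $H_{\alpha_2}=H_2-H_3$, and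 root vectors $X_{\alpha_2}=X_{\varepsilon_2-\varepsilon_3}$, $X_{3\alpha_1+\alpha_2}=-X_{\varepsilon_1+\varepsilon_3}$, $X_{3\alpha_1+2\alpha_2}=-X_{\varepsilon_1+\varepsilon_2}$, $X_{\alpha_1}=X_{\varepsilon_3}+X_{\varepsilon_1-\varepsilon_2}$, $X_{\alpha_1+\alpha_2}=X_{\varepsilon_2}-X_{\varepsilon_1-\varepsilon_3}$, $X_{2\alpha_1+\alpha_2}=-X_{\varepsilon_1}-X_{\varepsilon_2+\varepsilon_3}$, $X_{-\alpha_2}=X_{\varepsilon_3-\varepsilon_2}$, $X_{-3\alpha_1-\alpha_2}=X_{-\varepsilon_1-\varepsilon_3}$, $X_{-3\alpha_1-2\alpha_2}=X_{-\varepsilon_1-\varepsilon_2}$, $X_{-\alpha_1}=X_{-\varepsilon_3}+X_{\varepsilon_2-\varepsilon_1}$, $X_{-\alpha_1-\alpha_2}=X_{-\varepsilon_2}-X_{\varepsilon_3-\varepsilon_1}$, $X_{-2\alpha_1-\alpha_2}=-X_{-\varepsilon_1}-X_{-\varepsilon_2-\varepsilon_3}$, where $X_\gamma$ denotes a nonzero root vector of $so(7,\mathbb{C})$ for $\gamma$, normalized (as in the Levasseur–Smith Chevalley basis) so that these elements and $\mathfrak{h}_{\mathfrak{g}_2}$ span a Lie subalgebra isomorphic to $\mathfrak{g}_2$. The simple roots of $\mathfrak{g}_2$ are $\alpha_1=(\varepsilon_1-\varepsilon_2)|_{\mathfrak{h}_{\mathfrak{g}_2}}=\varepsilon_3|_{\mathfrak{h}_{\mathfrak{g}_2}}$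 and $\alpha_2=(\varepsilon_2-\varepsilon_3)|_{\mathfrak{h}_{\mathfrak{g}_2}}$. Standard parabolics: $\mathfrak{p}_\Pi=\mathfrak{h}_{\mathfrak{g}}+\sum_{\alpha\in\Phi^+(\mathfrak{g})}\mathfrak{g}_\alpha+\sum_{\alpha\in\mathbb{N}\Pi\cap\Phi^+(\mathfrak{g})}\mathfrak{g}_{-\alpha}$, where $\mathfrak g=so(7,\mathbb{C})$ and $\mathbb{N}$ denotes the nonnegative integers. Compatibility: a semisimple element $H$ of a complex reductive Lie algebra $\mathfrak{g}$ is hyperbolic if all eigenvalues of $\mathrm{ad}(H)$ are real; then $\mathfrak{p}(H)$ denotes the parabolic subalgebra which is the sum of the eigenspaces of $\mathrm{ad}(H)$ on $\mathfrak{g}$ with eigenvalues $\ge0$. For a reductive subalgebra $\mathfrak{g}'\subseteq\mathfrak{g}$, a parabolic subalgebra $\mathfrak{p}$ of $\mathfrak{g}$ is $\mathfrak{g}'$-compatible if there is a hyperbolic element $H$ of $\mathfrak{g}$ with $H\in\mathfrak{g}'$ and $\mathfrak{p}=\mathfrak{p}(H)$. *)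

(* Defs.v *)
From HB Require Import structures.
From mathcomp Require Import all_boot all_order all_algebra.
From mathcomp Require Import complex boolp reals.

Set Implicit Arguments.
Unset Strict Implicit.
Unset Printing Implicit Defensive.

Import Order.TTheory GRing.Theory Num.Theory.
Local Open Scope ring_scope.

Section LieMatrices.
Variables (K : fieldType) (n : nat).
Implicit Types (X Y H : 'M[K]_n) (g : {vspace 'M[K]_n}).

Definition lie X Y : 'M[K]_n := X *m Y - Y *m X.

Lemma lie_is_linear X : linear (lie X).
Proof.
move=> a Y Z; rewrite /lie mulmxDr mulmxDl -scalemxAr -scalemxAl.
by rewrite scalerBr opprD addrACA.
Qed.
HB.instance Definition _ X :=
  GRing.isLinear.Build K 'M[K]_n 'M[K]_n _ (lie X) (lie_is_linear X).

Definition ad X : 'End('M[K]_n) := linfun (lie X).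

Lemma adE X Y : ad X Y = X *m Y - Y *m X.
Proof. by rewrite lfunE. Qed.

Definition lie_closed g : Prop := {in g &, forall X Y, lie X Y \in g}.

(* eigenspace of ad(H) restricted to g; it is 0 if a is not an eigenvalue *)
Definition ad_eigenspace g H (a : K) : {vspace 'M[K]_n} :=
  (g :&: passmx.leigenspace (ad H) a)%VS.

Lemma ad_eigenspaceP g H a X :
  (X \in ad_eigenspace g H a) = (X \in g) && (lie H X == a *: X).
Proof.
rewrite memv_cap memv_ker add_lfunE opp_lfunE scale_lfunE id_lfunE subr_eq0.
by rewrite lfunE.
Qed.

(* H belongs to g and ad(H) is diagonalizable on g *)
Definition semisimple_in g H : Prop :=
  H \in g /\
  exists s : seq K, (g <= \sum_(a <- s) ad_eigenspace g H a)%VS.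

End LieMatrices.

Section Compatibility.
Variables (R : realType) (n : nat).
Local Notation C := R[i].
Implicit Types (X H : 'M[C]_n) (g p : {vspace 'M[C]_n}).

Definition hyperbolic_in g H : Prop :=
  semisimple_in g H /\
  forall a : C, ad_eigenspace g H a != 0%VS -> a \is Num.real.

(* X lies in p(H): the order on R[i] is such that 0 <= a means that a is real
   and nonnegative *)
Definition in_parabolic_of g H X : Prop :=
  exists2 s : seq C, all (fun a => 0 <= a) s
                   & X \in (\sum_(a <- s) ad_eigenspace g H a)%VS.

Definition compatible g g' p : Prop :=
  exists H, [/\ hyperbolic_in g H, H \in g' &
                forall X, X \in p <-> in_parabolic_of g H X].

End Compatibility.

Section So7.
Variable C : fieldType.
Implicit Types (X Y : 'M[C]_7) (z : 'cV[C]_7) (i j : 'I_3).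

(* i and i + 3 (for the 1-based z_1, ..., z_7 and i = 1, 2, 3), 0-based *)
Definition lo i : 'I_7 := inord i.
Definition hi i : 'I_7 := inord (i + 3).

(* Gram matrix of 2(z_1z_4 + z_2z_5 + z_3z_6) + z_7^2 *)
Definition gram : 'M[C]_7 :=
  \sum_i (delta_mx (lo i) (hi i) + delta_mx (hi i) (lo i))
  + delta_mx ord_max ord_max.

Lemma gram_quadratic z :
  (z^T *m gram *m z) 0 0
  = 2 * (\sum_i z (lo i) 0 * z (hi i) 0) + z ord_max 0 ^+ 2.
Proof.
have dE a b : (z^T *m delta_mx a b *m z) 0 0 = z a 0 * z b 0.
  rewrite -mulmxA -(mul_delta_mx (0 : 'I_1)) -mulmxA mulmxA -colE -rowE.
  by rewrite mxE big_ord1 !mxE.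
rewrite mulmxDr mulmxDl mulmx_sumr mulmx_suml mxE dE -expr2; congr (_ + _).
rewrite summxE mulr_sumr; apply: eq_bigr => i _.
by rewrite mulmxDr mulmxDl mxE !dE [z (hi i) 0 * _]mulrC -mulr2n mulr_natl.
Qed.

Definition skew_defect X : 'M[C]_7 := X^T *m gram + gram *m X.

Lemma skew_defect_is_linear : linear skew_defect.
Proof.
move=> a X Y; rewrite /skew_defect; move: gram => J.
rewrite linearP /= mulmxDl mulmxDr.
by rewrite -scalemxAl -scalemxAr scalerDr addrACA.
Qed.
HB.instance Definition _ :=
  GRing.isLinear.Build C 'M[C]_7 'M[C]_7 _ skew_defect skew_defect_is_linear.

Definition so7 : {vspace 'M[C]_7} := lker (linfun skew_defect).

Lemma so7P X : reflect (X^T *m gram = - (gram *m X)) (X \in so7).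
Proof. by rewrite memv_ker lfunE /= addr_eq0; apply: eqP. Qed.

Definition Hc i : 'M[C]_7 := delta_mx (lo i) (lo i) - delta_mx (hi i) (hi i).

Definition cartan : {vspace 'M[C]_7} := <<[seq Hc i | i <- enum 'I_3]>>%VS.

End So7.

(* A weight of the Cartan subalgebra is given by its (integral) coordinates in
   the basis of the epsilons. *)
Notation weight := 'rV[int]_3.

Definition e1 : weight := delta_mx 0 0.
Definition e2 : weight := delta_mx 0 1.
Definition e3 : weight := delta_mx 0 2.

Definition pos_roots : seq weight :=
  [:: e1 - e2; e1 - e3; e2 - e3; e1 + e2; e1 + e3; e2 + e3; e1; e2; e3].

Definition roots : seq weight := pos_roots ++ [seq - c | c <- pos_roots].

Definition simple_root (k : 'I_3) : weight :=
  tnth [tuple e1 - e2; e2 - e3; e3] k.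

(* c is in NPi, for Pi a set of (indices of) simple roots *)
Definition nat_span (Pi : {set 'I_3}) (c : weight) : Prop :=
  exists m : 'I_3 -> nat, c = \sum_(k in Pi) simple_root k *+ m k.

Section Parabolics.
Variable C : fieldType.

Definition root_space (c : weight) : {vspace 'M[C]_7} :=
  (\bigcap_(i < 3) ad_eigenspace (so7 C) (Hc C i) (c 0%R i)%:~R)%VS.

Definition borel : {vspace 'M[C]_7} :=
  (cartan C + \sum_(c <- pos_roots) root_space c)%VS.

Definition parabolic (Pi : {set 'I_3}) : {vspace 'M[C]_7} :=
  (cartan C + \sum_(c <- pos_roots) root_space c
   + \sum_(c <- pos_roots | `[< nat_span Pi c >]) root_space (- c))%VS.

(* H_{alpha_1}, H_{alpha_2} and the twelve root vectors of g_2, for root vectors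
   X c of so(7) *)
Definition g2_generators (X : weight -> 'M[C]_7) : seq 'M[C]_7 :=
  [:: Hc C 0 - Hc C 1 + Hc C 2 *+ 2; Hc C 1 - Hc C 2;
      X (e2 - e3); - X (e1 + e3); - X (e1 + e2);
      X e3 + X (e1 - e2); X e2 - X (e1 - e3); - X e1 - X (e2 + e3);
      X (e3 - e2); X (- e1 - e3); X (- e1 - e2);
      X (- e3) + X (e2 - e1); X (- e2) - X (e3 - e1);
      - X (- e1) - X (- e2 - e3)].

Definition g2_span (X : weight -> 'M[C]_7) : {vspace 'M[C]_7} :=
  <<g2_generators X>>%VS.

(* The cross product on imaginary octonions, with e_i x e_{i+1} = e_{i+3}
   (indices in Z/7, which is 'I_7); doubling the indices is an automorphism,
   so that e_i x e_{i+d} = e_{i+3d} for d = 1, 2, 4. *)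
Definition cross (x y : 'cV[C]_7) : 'cV[C]_7 :=
  \col_(k < 7) \sum_(d <- [:: 1; 2; 4] : seq 'I_7)
    (x (k - d *+ 3) 0 * y (k - d *+ 2) 0
     - x (k - d *+ 2) 0 * y (k - d *+ 3) 0).

(* The Lie algebra g_2 as the derivations of the octonions. *)
Definition cross_derivation (D : 'M[C]_7) : Prop :=
  forall x y, D *m cross x y = cross (D *m x) y + cross x (D *m y).

Definition isomorphic_g2 (g : {vspace 'M[C]_7}) : Prop :=
  exists f : 'End('M[C]_7),
    [/\ {in g &, injective f},
        {in g &, forall X Y, f (lie X Y) = lie (f X) (f Y)} &
        forall D, cross_derivation D <-> exists2 X, X \in g & D = f X].

(* X chooses a nonzero root vector for each root of so(7), normalized so that
   g2_span X is a Lie subalgebra isomorphic to g_2 *)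
Definition g2_normalized (X : weight -> 'M[C]_7) : Prop :=
  [/\ {in roots, forall c, X c \in root_space c /\ X c != 0},
      lie_closed (g2_span X) &
      isomorphic_g2 (g2_span X)].

End Parabolics.

(* Main.v *)
Require Import Defs.
From mathcomp Require Import all_boot all_order all_algebra.
From mathcomp Require Import complex boolp reals.
From mathcomp Require Import ring zify.

Import Order.TTheory GRing.Theory Num.Theory.
Local Open Scope ring_scope.

(** Write every positive root as a natural combination of simple roots, and let
    [level Pi c] be the sum of the coefficients of [c] on the simple roots
    outside [Pi].  This is an additive grading of the weights, and the standard
    parabolic of [Pi] is the sum of the pieces of nonnegative level
    ([parabolicP]): the positive roots of level 0 are those spanned by [Pi], and
    every other positive root has positive level.  In particular the parabolic is p(H)
    for the diagonal matrix [grading_elt Pi] that acts on each weight space by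
    its level.

    Sufficiency.  The diagonal matrices of g_2 are those on which
    e1 - e2 and e3, the simple roots of index 0 and 2, take the same value.  On
    [grading_elt Pi] the simple root of index k takes the value 0 or 1 according
    to whether k is in [Pi].  So [grading_elt Pi] lies in g_2 as soon as [Pi]
    contains both of the indices 0 and 2 or none of them, which is the case for
    exactly the four listed sets.

    Necessity.  Let the parabolic of [Pi] be p(H) with H in g_2; the point is
    that H need not be diagonal.  Eigenspaces of ad H are orthogonal for the
    trace form unless their eigenvalues are opposite, so tr([H,X] Y) = 0 for X
    and Y in p(H) ([mxtrace_lie_nonneg]).  Since p(H) contains the Borel
    subalgebra, taking X in the Cartan subalgebra and Y a positive root vector
    shows that H lies in the Borel subalgebra ([borel_triangular]).  Let a be a
    simple root, and a(H) its value on the diagonal part of H.  If the root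
    space of -a lies in p(H), taking for X and Y root vectors of a and -a gives
    a(H) = 0.  Conversely, if a(H) = 0, then ad H maps a root vector of -a into
    the Borel subalgebra, hence into p(H); and an element that ad H maps into
    p(H) is itself in p(H), because ad H is injective on the sum of the negative
    eigenspaces ([nonneg_part_absorb]).  So [Pi] consists of the simple roots
    that vanish on the diagonal part of H ([simple_root_levi]).  That diagonal
    part satisfies the equation of the Cartan subalgebra of g_2, because the
    root vectors have no diagonal part ([g2_span_diag]), so that e1 - e2 is in
    [Pi] if and only if e3 is. *)

Set Implicit Arguments.
Unset Strict Implicit.
Unset Printing Implicit Defensive.

(** * Sums of eigenspaces of ad H *)

Section EigenspaceSums.
Variables (K : fieldType) (n : nat) (g : {vspace 'M[K]_n}) (H : 'M[K]_n).

Local Notation eigensum s := (\sum_(a <- s) ad_eigenspace g H a)%VS.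

Lemma eigensum_ind (P : 'M[K]_n -> Prop) (s : seq K) :
  P 0 -> (forall X Y, P X -> P Y -> P (X + Y)) ->
  (forall a X, a \in s -> X \in ad_eigenspace g H a -> P X) ->
  forall X, X \in eigensum s -> P X.
Proof.
move=> P0 PD; elim: s => [|a s IHs] Ps X.
  by rewrite big_nil memv0 => /eqP ->.
rewrite big_cons => /memv_addP[Y Ya [Z Zs ->]]; apply: PD.
  by apply: Ps Ya; rewrite mem_head.
by apply: IHs Zs => b V bs; apply: Ps; rewrite inE bs orbT.
Qed.

Lemma eigensum_sup (a : K) (s : seq K) (X : 'M[K]_n) :
  a \in s -> X \in ad_eigenspace g H a -> X \in eigensum s.
Proof.
elim: s => // b s IHs; rewrite inE big_cons => /predU1P[<-|a_s] Xa.
  by rewrite (subvP (addvSl _ _)).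
by rewrite (subvP (addvSr _ _)) ?IHs.
Qed.

Lemma eigensum_lie (s : seq K) (X : 'M[K]_n) :
  X \in eigensum s -> lie H X \in eigensum s.
Proof.
apply: (@eigensum_ind (fun X => lie H X \in eigensum s)) => [|Y Z Ys Zs|a Y a_s].
- by rewrite linear0 mem0v.
- by rewrite linearD rpredD.
move=> Ya; apply: (eigensum_sup a_s).
have /eqP-> : lie H Y == a *: Y by move: Ya; rewrite ad_eigenspaceP => /andP[].
by rewrite memvZ.
Qed.

Lemma eigensum_sub (s : seq K) (X : 'M[K]_n) : X \in eigensum s -> X \in g.
Proof.
apply: (@eigensum_ind (fun X => X \in g)) => [|Y Z|a Y _]; first exact: mem0v.
  exact: rpredD.
by rewrite ad_eigenspaceP => /andP[].
Qed.

Lemma ad_eigenspace_eigensum (a : K) (t : seq K) (X : 'M[K]_n) :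
  a \notin t -> X \in ad_eigenspace g H a -> X \in eigensum t -> X = 0.
Proof.
elim: t X => [|b t IHt] X; first by rewrite big_nil memv0 => _ _ /eqP.
rewrite inE negb_or => /andP[neq_ab at'] Xa.
rewrite big_cons => /memv_addP[Y Yb [Z Zt defX]].
have: (a - b) *: X \in eigensum t.
  have HX: lie H X = a *: X by move: Xa; rewrite ad_eigenspaceP => /andP[_ /eqP].
  have HY: lie H Y = b *: Y by move: Yb; rewrite ad_eigenspaceP => /andP[_ /eqP].
  have -> : (a - b) *: X = lie H Z - b *: Z.
    by rewrite scalerBl -HX defX linearD /= HY scalerDr opprD addrACA subrr add0r.
  by rewrite rpredB ?memvZ ?eigensum_lie.
move/(IHt _ at' (memvZ _ Xa))/eqP.
by rewrite scaler_eq0 subr_eq0 (negPf neq_ab) => /eqP.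
Qed.

(** If [a] heads [s], then [ad H - a] maps a common element into the part of the
    sum over the tail of [s], where induction shows that it is 0. So the
    element is an eigenvector for [a], which does not occur in [t]. *)
Lemma eigensum_disjoint (s t : seq K) (X : 'M[K]_n) :
  {in s, forall a, a \notin t} ->
  X \in eigensum s -> X \in eigensum t -> X = 0.
Proof.
elim: s X => [|a s IHs] X st; first by rewrite big_nil memv0 => /eqP.
rewrite big_cons => /memv_addP[Y Ya [Z Zs defX]] Xt.
apply: (@ad_eigenspace_eigensum a t) => //; first by rewrite st ?mem_head.
have HY: lie H Y = a *: Y by move: Ya; rewrite ad_eigenspaceP => /andP[_ /eqP].
rewrite ad_eigenspaceP (eigensum_sub Xt) -subr_eq0; apply/eqP/IHs.
- by move=> b b_s; rewrite st // inE b_s orbT.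
- have -> : lie H X - a *: X = lie H Z - a *: Z.
    by rewrite defX linearD /= HY scalerDr opprD addrACA subrr add0r.
  by rewrite rpredB ?memvZ ?eigensum_lie.
by rewrite rpredB ?memvZ ?eigensum_lie.
Qed.

End EigenspaceSums.

Lemma lieC (F : fieldType) (n : nat) (X Y : 'M[F]_n) : lie X Y = - lie Y X.
Proof. by rewrite /lie opprB. Qed.

(** The trace form is invariant. *)
Lemma mxtrace_lieC (F : fieldType) (n : nat) (H X Y : 'M[F]_n) :
  \tr (lie H X *m Y) = - \tr (X *m lie H Y).
Proof.
have trB (A B : 'M[F]_n) : \tr (A - B) = \tr A - \tr B by exact: raddfB.
rewrite /lie mulmxBl mulmxBr !trB opprB -!mulmxA.
by rewrite [\tr (H *m _)]mxtrace_mulC -mulmxA.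
Qed.

Section NonnegPart.
Variables (K : numFieldType) (n : nat) (g : {vspace 'M[K]_n}) (H : 'M[K]_n).

(** The parabolic p(H), over any numeric field; over [R[i]] this unfolds to
    [in_parabolic_of]. *)
Definition nonneg_part (X : 'M[K]_n) : Prop :=
  exists2 s : seq K, all (fun a => 0 <= a) s
                   & X \in (\sum_(a <- s) ad_eigenspace g H a)%VS.

(** For eigenvectors X, Y with eigenvalues a, b, the trace is a tr(XY), and also
    - b tr(XY) by invariance; so (a + b) tr(XY) = 0, and a, b >= 0 can only sum
    to 0 if a = 0. *)
Lemma mxtrace_lie_nonneg (X Y : 'M[K]_n) :
  nonneg_part X -> nonneg_part Y -> \tr (lie H X *m Y) = 0.
Proof.
case=> s /allP s_ge0 Xs [t /allP t_ge0 Yt].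
apply: (@eigensum_ind _ _ g H (fun X => \tr (lie H X *m Y) = 0)) Xs.
- by rewrite linear0 mul0mx linear0.
- move=> U V /= U0 V0; have -> : lie H (U + V) = lie H U + lie H V by exact: linearD.
  by rewrite mulmxDl mxtraceD U0 V0 addr0.
move=> a U /s_ge0 a_ge0; rewrite ad_eigenspaceP => /andP[_ /eqP HU].
apply: (@eigensum_ind _ _ g H (fun Y => \tr (lie H U *m Y) = 0)) Yt.
- by rewrite mulmx0 linear0.
- by move=> V W /= V0 W0; rewrite mulmxDr mxtraceD V0 W0 addr0.
move=> b V /t_ge0 b_ge0; rewrite ad_eigenspaceP => /andP[_ /eqP HV].
have trUV: \tr (lie H U *m V) = a * \tr (U *m V) by rewrite HU -scalemxAl linearZ.
have: (a + b) * \tr (U *m V) = 0.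
  by rewrite mulrDl -trUV mxtrace_lieC HV -scalemxAr linearZ addNr.
rewrite trUV => /eqP; rewrite mulf_eq0 paddr_eq0 // => /orP[/andP[/eqP-> _]|/eqP->].
  by rewrite mul0r.
by rewrite mulr0.
Qed.

(** The component of X on the other eigenspaces is killed by ad H, since its image
    is also a sum of nonnegative components; as 0 is not among its eigenvalues,
    that component is 0. *)
Lemma nonneg_part_absorb (X : 'M[K]_n) :
  semisimple_in g H -> X \in g ->
  nonneg_part (lie H X) -> nonneg_part X.
Proof.
case=> _ [s g_s] Xg [t t_ge0 HXt].
pose s1 := [seq a <- s | 0 <= a]; pose s2 := [seq a <- s | ~~ (0 <= a)].
have /memv_addP[X1 X1s [X2 X2s defX]] :
    X \in (\sum_(a <- s1) ad_eigenspace g H a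
           + \sum_(a <- s2) ad_eigenspace g H a)%VS.
  by have := subvP g_s X Xg; rewrite (bigID (fun a => 0 <= a)) /= !big_filter.
have s1_ge0: all (fun a => 0 <= a) s1 by apply/allP => a; rewrite mem_filter => /andP[].
have HX20: lie H X2 = 0.
  apply: (@eigensum_disjoint _ _ g H s2 (t ++ s1)).
  - move=> a; rewrite mem_filter => /andP[a_lt0 _]; apply: contra a_lt0.
    by rewrite mem_cat => /orP[]; move: a; apply/allP.
  - exact: eigensum_lie.
  have -> : lie H X2 = lie H X - lie H X1 by rewrite defX linearD /= addrAC subrr add0r.
  rewrite big_cat /= rpredB //; first by rewrite (subvP (addvSl _ _)).
  by rewrite (subvP (addvSr _ _)) ?eigensum_lie.
have X2g := eigensum_sub X2s.
have X20: X2 = 0.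
  apply: (@eigensum_disjoint _ _ g H s2 [:: 0]) X2s _.
    by move=> a; rewrite mem_filter inE => /andP[a_lt0 _]; apply: contraNneq a_lt0 => ->.
  by rewrite big_seq1 ad_eigenspaceP X2g HX20 scale0r eqxx.
by exists s1 => //; rewrite defX X20 addr0.
Qed.

End NonnegPart.

(** * Weights of the coordinates and levels *)

Section Weights.

(** The coordinate that the quadratic form pairs with [i]: the last one is paired
    with itself. *)
Definition dual (i : 'I_7) : 'I_7 :=
  inord (if i < 3 then i + 3 else if i < 6 then i - 3 else i)%N.

Lemma val_dual (i : 'I_7) :
  dual i = (if i < 3 then i + 3 else if i < 6 then i - 3 else i)%N :> nat.
Proof. by rewrite inordK //; case: i => [[|[|[|[|[|[|[|]]]]]]]]. Qed.

Lemma dualK : involutive dual.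
Proof.
move=> i; apply: val_inj; rewrite /= !val_dual.
by case: i => [[|[|[|[|[|[|[|]]]]]]]].
Qed.

Lemma dual_eq (i j : 'I_7) : (dual i == j) = (i == dual j).
Proof. exact: can2_eq dualK dualK i j. Qed.

Lemma val_lo (k : 'I_3) : lo k = k :> nat.
Proof. by rewrite inordK // (ltn_trans (ltn_ord k)). Qed.

Lemma val_hi (k : 'I_3) : hi k = (k + 3)%N :> nat.
Proof. by rewrite inordK // (leq_ltn_trans _ (ltnSn 6)) // -ltnS (leq_add (ltn_ord k)). Qed.

Lemma dual_lo (k : 'I_3) : dual (lo k) = hi k.
Proof. by apply: val_inj; rewrite /= val_dual val_lo val_hi ltn_ord. Qed.

Lemma dual_cases (i : 'I_7) :
  [\/ exists k : 'I_3, i = lo k, exists k : 'I_3, i = hi k | dual i = i].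
Proof.
have [i3|i3] := ltnP i 3.
  by constructor 1; exists (Ordinal i3); apply: val_inj; rewrite /= val_lo.
have [i6|i6] := ltnP i 6.
  have i33: (i - 3 < 3)%N by rewrite ltn_subLR.
  by constructor 2; exists (Ordinal i33); apply: val_inj; rewrite /= val_hi subnK.
by constructor 3; apply: val_inj; rewrite /= val_dual (ltnNge i 3) i3 (ltnNge i 6) i6.
Qed.

(** The weight of the i-th coordinate vector under the Cartan subalgebra, so that
    the matrix unit (i, j) has weight [wt i - wt j]. *)
Definition wt (i : 'I_7) : weight :=
  \row_k ((i == lo k)%:R - (i == hi k)%:R).

Lemma wtE (i : 'I_7) (k : 'I_3) :
  wt i 0 k = ((i == k :> nat)%:R - (i == k + 3 :> nat)%N%:R).
Proof. by rewrite mxE -!val_eqE /= val_lo val_hi. Qed.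

Lemma wt_dual (i : 'I_7) : wt (dual i) = - wt i.
Proof.
apply/rowP => k; rewrite !mxE -!val_eqE /= val_lo val_hi val_dual.
by case: i k => [[|[|[|[|[|[|[|]]]]]]] ?] // [[|[|[|]]]].
Qed.

(** Weights are matrices, on which equality does not compute; triples of integers
   let membership in the list of roots be decided by evaluation. *)
Definition coords (c : weight) : int * int * int := (c 0 0, c 0 1, c 0 2).

Lemma coords_inj : injective coords.
Proof.
move=> c d [] c0 c1 c2; apply/rowP => -[[|[|[|k]]] k3] //.
- by move: c0; congr (c 0 _ = d 0 _); apply: val_inj.
- by move: c1; congr (c 0 _ = d 0 _); apply: val_inj.
by move: c2; congr (c 0 _ = d 0 _); apply: val_inj.
Qed.

Lemma coords_pos_roots : map coords pos_roots =
  [:: (1, -1, 0); (1, 0, -1); (0, 1, -1); (1, 1, 0); (1, 0, 1); (0, 1, 1);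
      (1, 0, 0); (0, 1, 0); (0, 0, 1)].
Proof. by rewrite /= /coords !mxE. Qed.

Lemma mem_pos_roots (c : weight) :
  (c \in pos_roots) = (coords c \in map coords pos_roots).
Proof. by rewrite (mem_map coords_inj). Qed.

(** The excluded pairs are the positions with weights 2 e_i and - 2 e_i, where all
    matrices of so(7) vanish. *)
Lemma wtB_root (i j : 'I_7) : j != dual i ->
  [\/ i = j, wt i - wt j \in pos_roots | wt j - wt i \in pos_roots].
Proof.
rewrite -val_eqE /= val_dual => j'i.
suff: [|| i == j :> nat, wt i - wt j \in pos_roots | wt j - wt i \in pos_roots].
  by case/or3P => [/eqP/val_inj||]; [constructor 1 | constructor 2 | constructor 3].
rewrite !mem_pos_roots coords_pos_roots /coords !mxE -!val_eqE /= !val_lo !val_hi.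
by move: j'i; case: i j => [[|[|[|[|[|[|[|]]]]]]] ?] // [[|[|[|[|[|[|[|]]]]]]] ?].
Qed.

(** The coefficient of [c] on [simple_root k]: the simple roots being
    e1 - e2, e2 - e3, e3, these are the partial sums of the coordinates. *)
Definition coef (k : 'I_3) (c : weight) : int := \sum_(j < 3 | (j <= k)%N) c 0 j.

(** The height of [c] relative to the simple roots outside [Pi]; it is the usual
    height if [Pi] is empty. *)
Definition level (Pi : {set 'I_3}) (c : weight) : int :=
  \sum_(k | k \notin Pi) coef k c.

Lemma levelB Pi c d : level Pi (c - d) = level Pi c - level Pi d.
Proof.
rewrite /level -sumrB; apply: eq_bigr => k _; rewrite -sumrB.
by apply: eq_bigr => j _; rewrite !mxE.
Qed.

Lemma level0 Pi : level Pi 0 = 0.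
Proof. by rewrite -[0 in LHS](subrr (0 : weight)) levelB subrr. Qed.

Lemma levelN Pi c : level Pi (- c) = - level Pi c.
Proof. by rewrite -[- c]sub0r levelB level0 sub0r. Qed.

Lemma levelD Pi c d : level Pi (c + d) = level Pi c + level Pi d.
Proof. by rewrite -[d in LHS]opprK levelB levelN opprK. Qed.

Lemma coef_simple_root (k l : 'I_3) : coef l (simple_root k) = (l == k)%:R.
Proof.
rewrite /coef big_mkcond !big_ord_recl big_ord0 /=.
by case: k l => [[|[|[|]]] ?] // [[|[|[|]]] ?] //; rewrite !mxE.
Qed.

Lemma level_simple_root Pi k : level Pi (simple_root k) = (k \notin Pi)%:R.
Proof.
rewrite /level big_mkcond (bigD1 k) //= coef_simple_root eqxx big1 ?addr0.
  by case: (k \in Pi).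
by move=> l /negPf lk; rewrite coef_simple_root lk if_same.
Qed.

Lemma sum_ord3 (V : nmodType) (F : 'I_3 -> V) :
  \sum_k F k = F 0 + F 1 + F 2.
Proof.
rewrite !big_ord_recl big_ord0 addr0 addrA.
by congr (F _ + F _ + F _); apply: val_inj.
Qed.

Lemma ord3_ind (P : 'I_3 -> Prop) : P 0 -> P 1 -> P 2 -> forall k, P k.
Proof.
move=> P0 P1 P2 [[|[|[|k]]] k3] //.
- by rewrite (_ : Ordinal k3 = 0) //; apply: val_inj.
- by rewrite (_ : Ordinal k3 = 1) //; apply: val_inj.
by rewrite (_ : Ordinal k3 = 2) //; apply: val_inj.
Qed.

Lemma coefE (c : weight) :
  [/\ coef 0 c = c 0 0, coef 1 c = c 0 0 + c 0 1
    & coef 2 c = c 0 0 + c 0 1 + c 0 2].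
Proof.
by rewrite /coef !(big_mkcond (fun j : 'I_3 => (j <= _)%N)) !sum_ord3 /= !addr0.
Qed.

(** The coordinate vectors have heights 3, 2, 1, -3, -2, -1, 0: ordered in this way,
    the Borel subalgebra is triangular. *)
Lemma level_wt_inj : injective (fun i => level set0 (wt i)).
Proof.
have levE c : level set0 c = c 0 0 + (c 0 0 + c 0 1) + (c 0 0 + c 0 1 + c 0 2).
  have [<- <- <-] := coefE c; rewrite -(sum_ord3 (coef^~ c)) /level.
  by apply: eq_bigl => k; rewrite inE.
move=> i j; rewrite !levE !wtE => eq_ij; apply: val_inj; move: eq_ij => /=.
by case: i j => [[|[|[|[|[|[|[|]]]]]]] ?] // [[|[|[|[|[|[|[|]]]]]]] ?].
Qed.

(** The matrix unit ([lo k], [simple_tgt k]) has weight [simple_root k]: these pairs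
    are (0, 1), (1, 2) and (2, 6). *)
Definition simple_tgt (k : 'I_3) : 'I_7 := inord (if k < 2 then k.+1 else 6)%N.

Lemma val_simple_tgt (k : 'I_3) :
  simple_tgt k = (if k < 2 then k.+1 else 6)%N :> nat.
Proof. by rewrite inordK //; case: k => [[|[|[|]]]]. Qed.

Lemma wtB_simple (k : 'I_3) : wt (lo k) - wt (simple_tgt k) = simple_root k.
Proof.
apply/rowP => l; rewrite mxE [in X in _ + X]mxE !wtE val_lo val_simple_tgt.
by case: k l => [[|[|[|]]] ?] // [[|[|[|]]] ?] //; rewrite !mxE.
Qed.

Lemma simple_tgt_neq (k : 'I_3) : simple_tgt k != dual (lo k).
Proof.
rewrite -val_eqE /= dual_lo val_hi val_simple_tgt.
by case: k => [[|[|[|]]] ?].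
Qed.

Lemma wt_lo (k l : 'I_3) : wt (lo k) 0 l = (k == l)%:R.
Proof.
by rewrite wtE val_lo; case: k l => [[|[|[|]]] ?] // [[|[|[|]]] ?].
Qed.

Lemma coef_pos_root (c : weight) :
  c \in pos_roots ->
  (forall k, 0 <= coef k c) /\ c = \sum_k simple_root k *+ `|coef k c|.
Proof.
case: (coefE c) => coef0E coef1E coef2E; rewrite mem_pos_roots coords_pos_roots.
rewrite /coords !inE => c_pos; split.
  apply: ord3_ind; rewrite ?coef0E ?coef1E ?coef2E;
  by repeat (case/predU1P: c_pos => [[x0 x1 x2]|c_pos]; first by rewrite ?x0 ?x1 ?x2);
     move/eqP: c_pos => [x0 x1 x2]; rewrite ?x0 ?x1 ?x2.
apply: coords_inj; rewrite sum_ord3 coef0E coef1E coef2E /coords !mxE !mulmxnE !mxE /=.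
by repeat (case/predU1P: c_pos => [[x0 x1 x2]|c_pos]; first by rewrite ?x0 ?x1 ?x2);
     move/eqP: c_pos => [x0 x1 x2]; rewrite ?x0 ?x1 ?x2.
Qed.

End Weights.

(** * Matrices of so(7) *)

Section So7Matrices.
Variable K : numFieldType.
Implicit Types X Y : 'M[K]_7.

Lemma gramE (i j : 'I_7) : gram K i j = (j == dual i)%:R.
Proof.
rewrite mxE summxE sum_ord3 !mxE -!val_eqE /= !val_lo !val_hi val_dual.
by case: i j => [[|[|[|[|[|[|[|]]]]]]] ?] // [[|[|[|[|[|[|[|]]]]]]] ?] //=;
   rewrite ?addr0 ?add0r.
Qed.

Lemma so7_entriesP X :
  X \in so7 K <-> forall i j, X (dual j) (dual i) = - X i j.
Proof.
have gramX i j : (gram K *m X) i j = X (dual i) j.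
  rewrite mxE (bigD1 (dual i)) //= gramE eqxx mul1r big1 ?addr0 // => k /negPf.
  by rewrite gramE => ->; rewrite mul0r.
have Xgram i j : (X^T *m gram K) i j = X (dual j) i.
  rewrite mxE (bigD1 (dual j)) //= gramE dualK eqxx mulr1 mxE big1 ?addr0 // => k.
  move/negPf => kj; by rewrite gramE -dual_eq eq_sym kj mulr0.
split=> [/so7P soX i j | soX].
  by have /matrixP/(_ (dual i) j) := soX; rewrite [RHS]mxE gramX Xgram dualK.
apply/so7P/matrixP => i j; rewrite [RHS]mxE gramX Xgram -[in LHS](dualK i) soX.
by [].
Qed.

Lemma so7_antidiag X i : X \in so7 K -> X i (dual i) = 0.
Proof.
move/so7_entriesP/(_ i (dual i)); rewrite dualK => /eqP.
by rewrite -addr_eq0 -mulr2n mulrn_eq0 => /eqP.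
Qed.

Lemma so7_lie X Y : X \in so7 K -> Y \in so7 K -> lie X Y \in so7 K.
Proof.
move=> /so7P soX /so7P soY; apply/so7P.
rewrite /lie linearB /= !trmx_mul mulmxBl -!mulmxA soX soY.
by rewrite !mulmxN !mulmxA soX soY !mulNmx mulmxBr !opprK opprB !mulmxA.
Qed.

(** Twice the projection to so(7) of the matrix unit (i, j): it is 0 if
    [j = dual i], an element of the Cartan subalgebra if [i = j], and a root vector
    otherwise. *)
Definition skew_unit (i j : 'I_7) : 'M[K]_7 :=
  delta_mx i j - delta_mx (dual j) (dual i).

Lemma skew_unitE i j a b :
  skew_unit i j a b
  = ((a == i) && (b == j))%:R - ((a == dual j) && (b == dual i))%:R.
Proof. by rewrite !mxE. Qed.

Lemma skew_unit_so7 i j : skew_unit i j \in so7 K.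
Proof.
apply/so7_entriesP => a b; rewrite !skew_unitE opprB.
by rewrite !dual_eq !dualK; congr (_%:R - _%:R); rewrite andbC.
Qed.

Lemma skew_unit_wt i j a b :
  skew_unit i j a b != 0 -> wt a - wt b = wt i - wt j.
Proof.
rewrite skew_unitE; case: andP => [[/eqP-> /eqP->] //|_].
case: andP => [[/eqP-> /eqP->] _|_]; last by rewrite subrr eqxx.
by rewrite !wt_dual opprK addrC.
Qed.

(** Each entry is counted twice, at (i, j) and at (dual j, dual i). *)
Lemma so7_skew_unit X :
  X \in so7 K -> X = \sum_i \sum_j (X i j / 2) *: skew_unit i j.
Proof.
move/so7_entriesP=> soX; rewrite {1}[X](_ : X = 2^-1 *: (X + X)); last first.
  by rewrite -mulr2n -scaler_nat scalerA mulVf ?scale1r ?pnatr_eq0.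
have XE : X = \sum_i \sum_j X i j *: delta_mx i j by apply: matrix_sum_delta.
have XE' : X = \sum_i \sum_j - X i j *: delta_mx (dual j) (dual i).
  rewrite {1}XE (reindex_inj (inv_inj dualK)) exchange_big.
  rewrite (reindex_inj (inv_inj dualK)) /=.
  by apply: eq_bigr => i _; apply: eq_bigr => j _; rewrite soX.
rewrite [Z in _ *: (Z + _)]XE [Z in _ *: (_ + Z)]XE' -big_split scaler_sumr.
apply: eq_bigr => i _.
rewrite -big_split scaler_sumr; apply: eq_bigr => j _.
by rewrite /= scaleNr -scalerBr scalerA mulrC.
Qed.

Lemma mxtrace_skew_unit X i j :
  X \in so7 K -> \tr (X *m skew_unit j i) = X i j *+ 2.
Proof.
have trE (Y : 'M[K]_7) a b : \tr (Y *m delta_mx a b) = Y b a.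
  rewrite /mxtrace (bigD1 b) //= mxE (bigD1 a) //= !mxE !eqxx mulr1.
  rewrite big1 ?addr0 => [|k /negPf ka]; last by rewrite mxE ka mulr0.
  rewrite big1 ?addr0 // => k /negPf kb; rewrite mxE big1 // => l _.
  by rewrite mxE kb andbF mulr0.
by move=> /so7_entriesP soX; rewrite mulmxBr raddfB /= !trE soX opprK mulr2n.
Qed.

End So7Matrices.

(** * Standard parabolics and the grading by levels *)

Section StandardParabolics.
Variable K : numFieldType.
Implicit Types X Y : 'M[K]_7.

Lemma lie_diag (d : 'rV[K]_7) X i j :
  lie (diag_mx d) X i j = (d 0 i - d 0 j) * X i j.
Proof.
by rewrite /lie mul_diag_mx mul_mx_diag !mxE mulrBl [_ * d 0 j]mulrC.
Qed.

Lemma ad_eigenspace_diagP (d : 'rV[K]_7) (a : K) X :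
  X \in ad_eigenspace (so7 K) (diag_mx d) a <->
  X \in so7 K /\ forall i j, X i j != 0 -> d 0 i - d 0 j = a.
Proof.
rewrite ad_eigenspaceP; split=> [/andP[-> /eqP/matrixP DX]|[-> dX]].
  split=> // i j Xij; apply: (mulIf Xij); rewrite -lie_diag.
  by have := DX i j; rewrite [RHS]mxE.
apply/eqP/matrixP => i j; rewrite lie_diag [RHS]mxE.
by case: (eqVneq (X i j) 0) => [->|/dX->//]; rewrite !mulr0.
Qed.

Lemma Hc_diag k : Hc K k = diag_mx (\row_i (wt i 0 k)%:~R).
Proof.
apply/matrixP => i j; rewrite !mxE rmorphB /= !rmorph_nat.
have [<-|ij] := eqVneq i j; first by rewrite !andbb.
have neq (l : 'I_7) : (i == l) && (j == l) = false.
  by apply: contraNF ij => /andP[/eqP-> /eqP->].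
by rewrite !neq subrr mulr0n.
Qed.

Lemma root_spaceP c X :
  X \in root_space K c <->
  X \in so7 K /\ forall i j, X i j != 0 -> wt i - wt j = c.
Proof.
have eigP k := ad_eigenspace_diagP (\row_i (wt i 0 k)%:~R) (c 0 k)%:~R X.
split=> [|[soX cX]].
  rewrite memvE => /subv_bigcapP Xc.
  have {}Xc k : X \in ad_eigenspace (so7 K) (Hc K k) (c 0 k)%:~R.
    by rewrite memvE; apply: Xc.
  split=> [|i j Xij].
    by have := Xc 0; rewrite Hc_diag => /eigP[].
  apply/rowP => k; have := Xc k; rewrite Hc_diag => /eigP[_ /(_ i j Xij)].
  rewrite [Z in Z - _ = _]mxE [Z in _ - Z = _]mxE -rmorphB => /intr_inj <-.
  by rewrite !mxE.
rewrite memvE; apply/subv_bigcapP => k _; rewrite -memvE Hc_diag.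
apply: (proj2 (eigP k)); split=> // i j /cX <-.
by rewrite !mxE !rmorphB.
Qed.

Lemma skew_unit_root_space i j : skew_unit K i j \in root_space K (wt i - wt j).
Proof.
by apply/root_spaceP; split=> [|a b]; [apply: skew_unit_so7 | apply: skew_unit_wt].
Qed.

Lemma Hc_so7 k : Hc K k \in so7 K.
Proof.
apply/so7_entriesP => i j; rewrite Hc_diag !mxE (inj_eq (inv_inj dualK)).
rewrite [j == i]eq_sym; case: (eqVneq i j) => [<-|_]; last by rewrite !mulr0n oppr0.
by have /rowP/(_ k) := wt_dual i; rewrite !mxE => ->; rewrite !mulr1n rmorphN.
Qed.

Lemma cartan_root_space0 : (cartan K <= root_space K 0)%VS.
Proof.
apply/span_subvP => _ /mapP[k _ ->]; apply/root_spaceP; split=> [|i j].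
  exact: Hc_so7.
rewrite Hc_diag mxE; case: (eqVneq i j) => [->|_]; first by rewrite subrr.
by rewrite mulr0n eqxx.
Qed.

Lemma Hc_cartan k : Hc K k \in cartan K.
Proof. by apply/memv_span/map_f; rewrite mem_enum. Qed.

Lemma skew_unit_cartan i : skew_unit K i i \in cartan K.
Proof.
case: (dual_cases i) => [[k ->]|[k ->]|di]; rewrite /skew_unit.
- by rewrite dual_lo Hc_cartan.
- by rewrite -opprB rpredN -dual_lo dualK dual_lo Hc_cartan.
by rewrite di subrr mem0v.
Qed.

(** Membership in the parabolic of [Pi], as a condition on the entries; the
    equivalence is [parabolicP]. *)
Definition leveled (Pi : {set 'I_3}) X : Prop :=
  X \in so7 K /\ forall i j, X i j != 0 -> 0 <= level Pi (wt i - wt j).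

Lemma level_pos_root_ge0 Pi c : c \in pos_roots -> 0 <= level Pi c.
Proof. by case/coef_pos_root => c_ge0 _; apply: sumr_ge0. Qed.

(** The level is a sum of nonnegative coefficients, those of the simple roots
    outside [Pi]; so it is 0 exactly if they all are. *)
Lemma level_nat_span Pi c :
  c \in pos_roots -> level Pi c = 0 <-> nat_span Pi c.
Proof.
move=> c_pos; have [c_ge0 defc] := coef_pos_root c_pos; split=> [c0|[m ->]].
  exists (fun k => `|coef k c|%N).
  have {}c0 k : k \notin Pi -> coef k c = 0.
    by move=> Pi'k; apply: (psumr_eq0P _ c0) => // l _; apply: c_ge0.
  rewrite {1}defc (bigID (mem Pi)) /= [X in _ + X]big1 ?addr0 // => k Pi'k.
  by rewrite c0.
apply: (big_ind (fun d => level Pi d = 0)) => [|d e d0 e0|k Pik].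
- exact: level0.
- by rewrite levelD d0 e0.
elim: (m k) => [|l IHl]; first by rewrite mulr0n level0.
by rewrite mulrS levelD IHl level_simple_root Pik.
Qed.

Lemma sumv_seq_sup (V : vectType K) (I : eqType) (r : seq I) (P : pred I)
    (U : I -> {vspace V}) i :
  i \in r -> P i -> (U i <= \sum_(j <- r | P j) U j)%VS.
Proof.
elim: r => // j r IHr; rewrite inE big_cons => /predU1P[<- ->|ir Pi].
  exact: addvSl.
by case: ifP => _; rewrite ?(subv_trans (IHr ir Pi)) ?addvSr.
Qed.

Lemma memv_leveled Pi (U : {vspace 'M[K]_7}) :
  (forall i j, 0 <= level Pi (wt i - wt j) -> j != dual i -> skew_unit K i j \in U) ->
  forall X, leveled Pi X -> X \in U.
Proof.
move=> PiU X [soX lX]; rewrite (so7_skew_unit soX).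
apply: memv_suml => i _; apply: memv_suml => j _.
have [->|Xij] := eqVneq (X i j) 0; first by rewrite mul0r scale0r mem0v.
by rewrite memvZ ?PiU ?lX //; apply: contraNneq Xij => ->; rewrite so7_antidiag.
Qed.

Lemma leveled0 Pi : leveled Pi 0.
Proof. by split=> [|i j]; rewrite ?mem0v // mxE eqxx. Qed.

Lemma leveledD Pi X Y : leveled Pi X -> leveled Pi Y -> leveled Pi (X + Y).
Proof.
case=> soX lX [soY lY]; split=> [|i j]; first exact: rpredD.
rewrite mxE => XYij; case: (eqVneq (X i j) 0) => [X0|/lX//]; apply: lY.
by apply: contraNneq XYij => Y0; rewrite X0 Y0 addr0.
Qed.

Lemma sumv_leveled Pi (r : seq weight) (P : pred weight) (U : weight -> {vspace 'M[K]_7}) :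
  {in r, forall c, P c -> {in U c, forall X, leveled Pi X}} ->
  {in (\sum_(c <- r | P c) U c)%VS, forall X, leveled Pi X}.
Proof.
elim: r => [|c r IHr] rU X; first by rewrite big_nil memv0 => /eqP->; apply: leveled0.
have {}IHr : {in (\sum_(c <- r | P c) U c)%VS, forall X, leveled Pi X}.
  by apply: IHr => d dr; apply: rU; rewrite inE dr orbT.
rewrite big_cons; case: ifP => [Pc|_]; last exact: IHr.
by case/memv_addP=> [Y /(rU c (mem_head _ _) Pc) lY [Z /IHr lZ ->]]; apply: leveledD.
Qed.

Lemma root_space_leveled Pi c X :
  X \in root_space K c -> 0 <= level Pi c -> leveled Pi X.
Proof. by case/root_spaceP => soX cX c_ge0; split=> // i j /cX->. Qed.

(** A matrix of nonnegative level is a combination of the [skew_unit i j] with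
    [wt i - wt j] of nonnegative level. Such a weight is 0, a positive root, or
    the opposite of a positive root, which is then of level 0 and hence spanned
    by [Pi]. *)
Lemma parabolicP Pi X : X \in parabolic K Pi <-> leveled Pi X.
Proof.
split=> [|lX].
  case/memv_addP=> [_ /memv_addP[Y Yh [Z Zb ->]] [V Vn ->]].
  apply: leveledD; first apply: leveledD.
  - by apply: (@root_space_leveled _ 0); rewrite ?level0 // (subvP cartan_root_space0).
  - apply: sumv_leveled Zb => c c_pos _ {}Z /root_space_leveled; apply.
    exact: level_pos_root_ge0.
  apply: sumv_leveled Vn => c c_pos /asboolP/level_nat_span c0 {}V /root_space_leveled.
  by apply; rewrite levelN c0.
apply: memv_leveled lX => i j ij_ge0 /wtB_root[<-|ij_pos|ji_pos]; rewrite /parabolic.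
- by rewrite !(subvP (addvSl _ _)) ?skew_unit_cartan.
- rewrite (subvP (addvSl _ _)) // (subvP (addvSr _ _)) //.
  by apply: subvP (skew_unit_root_space i j); apply: sumv_seq_sup.
rewrite (subvP (addvSr _ _)) //.
apply: subvP (skew_unit_root_space i j); rewrite -opprB.
apply: (@sumv_seq_sup _ _ _ _ (fun c => root_space K (- c))) => //.
apply/asboolP/level_nat_span => //; apply/eqP; rewrite eq_le level_pos_root_ge0 //.
by rewrite andbT -oppr_ge0 -levelN opprB.
Qed.

Lemma parabolic_set0 : parabolic K set0 = borel K.
Proof.
rewrite /parabolic [X in (_ + X)%VS]big1_seq ?addv0 // => c /andP[/asboolP[m c0] c_pos].
by move: c_pos; rewrite c0 big_set0 mem_pos_roots coords_pos_roots /coords !mxE.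
Qed.

Lemma parabolic_setT : parabolic K [set: 'I_3] = so7 K.
Proof.
apply/vspaceP => X; apply/idP/idP => [/parabolicP[]//|soX].
by apply/parabolicP; split=> // i j _; rewrite /level big_pred0 // => k; rewrite inE.
Qed.

(** The set [Pi] can be read off the parabolic, which contains a root vector of
    - [simple_root k] exactly if [k] is in [Pi]. *)
Lemma parabolic_inj (X : weight -> 'M[K]_7) :
  (forall k, X (- simple_root k) \in root_space K (- simple_root k) /\
             X (- simple_root k) != 0) ->
  injective (@parabolic K).
Proof.
move=> rootX Pi1 Pi2 eqPi; apply/setP => k; have [Xk Xk0] := rootX k.
suff memPi (Pi : {set 'I_3}) : (k \in Pi) = (X (- simple_root k) \in parabolic K Pi).
  by rewrite !memPi eqPi.
have levk : level Pi (- simple_root k) = - (k \notin Pi)%:R.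
  by rewrite levelN level_simple_root.
apply/idP/idP => [Pik|/parabolicP[_ lX]].
  by apply/parabolicP/(root_space_leveled Xk); rewrite levk Pik.
have /existsP[i /existsP[j Xij]] : [exists i, exists j, X (- simple_root k) i j != 0].
  apply: contra_neqT Xk0; rewrite negb_exists => /forallP X0; apply/matrixP => i j.
  by have := X0 i; rewrite negb_exists mxE => /forallP/(_ j)/negPn/eqP.
have := lX i j Xij; case/root_spaceP: Xk => _ ->//; rewrite levk.
by case: (k \in Pi).
Qed.

End StandardParabolics.

(** * The grading element *)

Section GradingElement.
Variable K : numFieldType.
Implicit Types (X Y : 'M[K]_7) (Pi : {set 'I_3}).

Definition grading_elt Pi : 'M[K]_7 := diag_mx (\row_i (level Pi (wt i))%:~R).

Lemma grading_eigenspaceP Pi (a : K) X :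
  X \in ad_eigenspace (so7 K) (grading_elt Pi) a <->
  X \in so7 K /\ forall i j, X i j != 0 -> (level Pi (wt i - wt j))%:~R = a.
Proof.
rewrite /grading_elt; split=> [/ad_eigenspace_diagP[soX aX]|[soX aX]].
  by split=> // i j /aX; rewrite !mxE -rmorphB levelB.
by apply/ad_eigenspace_diagP; split=> // i j /aX; rewrite !mxE -rmorphB levelB.
Qed.

Lemma skew_unit_grading Pi i j :
  skew_unit K i j \in
    ad_eigenspace (so7 K) (grading_elt Pi) (level Pi (wt i - wt j))%:~R.
Proof.
apply/grading_eigenspaceP; split=> [|a b /skew_unit_wt->//].
exact: skew_unit_so7.
Qed.

Lemma grading_elt_Hc Pi :
  grading_elt Pi = \sum_k (level Pi (wt (lo k)))%:~R *: Hc K k.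
Proof.
rewrite [RHS](_ : _ = \sum_k diag_mx (\row_i (level Pi (wt (lo k)) * wt i 0 k)%:~R)).
  rewrite -raddf_sum; congr diag_mx; apply/rowP => i; rewrite mxE summxE.
  rewrite (eq_bigr (fun k => (level Pi (wt (lo k)) * wt i 0 k)%:~R)); last first.
    by move=> k _; rewrite mxE.
  rewrite -rmorph_sum /=; congr (_%:~R).
  have lev_lo l : \sum_k level Pi (wt (lo k)) * wt (lo l) 0 k = level Pi (wt (lo l)).
    rewrite (bigD1 l) //= wt_lo eqxx mulr1 big1 ?addr0 // => k /negPf kl.
    by rewrite wt_lo eq_sym kl mulr0.
  case: (dual_cases i) => [[l ->]|[l ->]|di]; first by rewrite lev_lo.
    rewrite -dual_lo wt_dual levelN -lev_lo -sumrN.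
    by apply: eq_bigr => k _; rewrite [(- _ : weight) 0 k]mxE mulrN.
  have wi k : wt i 0 k = 0.
    have /rowP/(_ k)/eqP := wt_dual i.
    rewrite di [(- _ : weight) 0 k]mxE -addr_eq0 -mulr2n mulrn_eq0.
    by move/eqP.
  rewrite big1 => [|k _]; last by rewrite wi mulr0.
  by rewrite (_ : wt i = 0) ?level0 //; apply/rowP => k; rewrite wi mxE.
apply: eq_bigr => k _; rewrite Hc_diag; apply/matrixP => i j.
by rewrite !mxE rmorphM mulrnAr.
Qed.

Lemma grading_elt_so7 Pi : grading_elt Pi \in so7 K.
Proof. by rewrite grading_elt_Hc; apply: memv_suml => k _; rewrite memvZ ?Hc_so7. Qed.

(** If a1, a2, a3 are the coordinates of the grading element on H_1, H_2, H_3, the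
    hypothesis says that a1 - a2 = a3, and then the element is
    a1 H_{alpha_1} + (a1 + a2) H_{alpha_2}. *)
Lemma grading_elt_g2 Pi (X : weight -> 'M[K]_7) :
  (0 \in Pi) = (2 \in Pi) -> grading_elt Pi \in g2_span X.
Proof.
move=> Pi02; rewrite grading_elt_Hc sum_ord3.
have : level Pi (wt (lo 0)) - level Pi (wt (lo 1)) = level Pi (wt (lo 2)).
  rewrite -levelB; have -> : lo 1 = simple_tgt 0 by [].
  (* e3 is the difference between the weights of the third and the last
     coordinate, and the latter is 0. *)
  have wt6 : wt (simple_tgt 2) = 0.
    by apply/rowP => k; rewrite wtE val_simple_tgt mxE; case: k => [[|[|[|]]]].
  by rewrite wtB_simple -[wt (lo 2)]subr0 -wt6 wtB_simple !level_simple_root Pi02.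
set c0 := level Pi _; set c1 := level Pi _ => <-.
rewrite [X in X \in _](_ : _ =
  c0%:~R *: (Hc K 0 - Hc K 1 + Hc K 2 *+ 2) + (c0 + c1)%:~R *: (Hc K 1 - Hc K 2)).
  by rewrite rpredD ?memvZ ?memv_span // !inE eqxx ?orbT.
apply/matrixP => i j; move: (Hc K 0) (Hc K 1) (Hc K 2) => A B C; rewrite !mxE.
rewrite rmorphB rmorphD /=; ring.
Qed.

Lemma grading_elt_semisimple Pi : semisimple_in (so7 K) (grading_elt Pi).
Proof.
split; first exact: grading_elt_so7.
exists [seq (level Pi (wt i - wt j))%:~R | i <- enum 'I_7, j <- enum 'I_7].
apply/subvP => X soX; rewrite (so7_skew_unit soX).
apply: memv_suml => i _; apply: memv_suml => j _; apply: memvZ.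
apply: eigensum_sup (skew_unit_grading Pi i j).
by apply/allpairsP; exists (i, j); rewrite !mem_enum.
Qed.

Lemma grading_elt_real Pi (a : K) :
  ad_eigenspace (so7 K) (grading_elt Pi) a != 0%VS -> a \is Num.real.
Proof.
rewrite -vpick0; have /grading_eigenspaceP[_ aX] :=
  memv_pick (ad_eigenspace (so7 K) (grading_elt Pi) a).
move=> /matrix0Pn[i [j /aX <-]].
by rewrite realz.
Qed.

Lemma nonneg_gradingP Pi X :
  nonneg_part (so7 K) (grading_elt Pi) X <-> leveled Pi X.
Proof.
split=> [[s /allP s_ge0]|lX].
  apply: (@eigensum_ind _ _ (so7 K) (grading_elt Pi) (leveled Pi)).
  - exact: leveled0.
  - exact: leveledD.
  move=> a Y /s_ge0 a_ge0 /grading_eigenspaceP[soY aY]; split=> // i j /aY aE.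
  by rewrite -(ler0z K) aE.
exists [seq a <- [seq (level Pi (wt i - wt j))%:~R | i <- enum 'I_7, j <- enum 'I_7] | 0 <= a].
  by apply/allP => a; rewrite mem_filter => /andP[].
apply: memv_leveled lX => i j ij_ge0 _.
apply: eigensum_sup (skew_unit_grading Pi i j); rewrite mem_filter ler0z ij_ge0.
by apply/allpairsP; exists (i, j); rewrite !mem_enum.
Qed.

End GradingElement.

(** * Parabolics p(H) that contain the Borel subalgebra *)

Section ContainsBorel.
Variables (K : numFieldType) (H : 'M[K]_7).
Hypothesis Hss : semisimple_in (so7 K) H.
Hypothesis borelH : forall X, X \in borel K -> nonneg_part (so7 K) H X.
Implicit Types X Y : 'M[K]_7.

Local Notation nonneg := (nonneg_part (so7 K) H).

(** [skew_unit j i] detects the entry (i, j) for the trace form. *)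
Lemma lie_nonneg_entry X i j :
  X \in so7 K -> nonneg X -> nonneg (skew_unit K j i) -> lie H X i j = 0.
Proof.
move=> soX pX pE; have := mxtrace_lie_nonneg pX pE.
rewrite mxtrace_skew_unit ?so7_lie //; last by case: Hss.
by move/eqP; rewrite mulrn_eq0 => /eqP.
Qed.

Lemma lie_skew_unit_entry i j : j != dual i -> lie H (skew_unit K i j) i j = H i i - H j j.
Proof.
move=> ij'; have ji' : i != dual j by rewrite eq_sym dual_eq.
rewrite /lie [LHS]mxE [X in _ + X]mxE [X in X - _]mxE [X in _ - X]mxE.
rewrite (bigD1 i) //= [X in _ - X](bigD1 j) //= !skew_unitE !eqxx.
rewrite (negPf ij') (negPf ji') !andbF /= subr0 mulr1 mul1r.
by rewrite !big1 ?addr0 // => k /negPf ki; rewrite !skew_unitE ki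
   ?(negPf ij') ?(negPf ji') ?andbF /= subrr ?mulr0 ?mul0r.
Qed.

(** For [wt i - wt j] of negative height, [skew_unit j i] lies in the Borel
    subalgebra, and bracketing H with the Cartan subalgebra multiplies the entry
    (i, j) of H by the values of a nonzero weight. *)
Lemma borel_triangular i j : H i j != 0 -> 0 <= level set0 (wt i - wt j).
Proof.
move=> Hij; rewrite leNgt; apply/negP => ij_lt0.
have pE : nonneg (skew_unit K j i).
  apply: borelH; rewrite -parabolic_set0; apply/parabolicP.
  apply: root_space_leveled (skew_unit_root_space K j i) _.
  by rewrite -opprB levelN oppr_ge0 ltW.
have wt_ij k : wt i 0 k = wt j 0 k.
  have: lie H (Hc K k) i j = 0.
    apply: lie_nonneg_entry => //; first exact: Hc_so7.
    apply: borelH; rewrite /borel (subvP (addvSl _ _)) //; exact: Hc_cartan.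
  rewrite Hc_diag lieC mxE lie_diag => /eqP; rewrite oppr_eq0 mulf_eq0 (negPf Hij) orbF subr_eq0.
  by rewrite ![(\row_i _) 0 _]mxE => /eqP/intr_inj.
by move: ij_lt0; rewrite (_ : wt i = wt j) ?subrr ?level0 //; apply/rowP.
Qed.

(** If the simple root vanishes on the diagonal of H, the bracket of H with the
    negative root vector E has entries of nonnegative height only. For H does
    not lower heights and E lowers them by 1, so a product of entries of H and E
    that lowers the height has a diagonal factor from H, and what remains is
    the value of the simple root times E. *)
Lemma simple_root_nonnegP k :
  nonneg (skew_unit K (simple_tgt k) (lo k)) <->
  H (lo k) (lo k) = H (simple_tgt k) (simple_tgt k).
Proof.
set i := lo k; set j := simple_tgt k.
have ij' : j != dual i := simple_tgt_neq k.
have lev_ij : level set0 (wt i) - level set0 (wt j) = 1.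
  by rewrite -levelB wtB_simple level_simple_root inE.
have soH : H \in so7 K by case: Hss.
split=> [pE|Hij].
  apply/eqP; rewrite -subr_eq0 -(lie_skew_unit_entry ij'); apply/eqP.
  apply: lie_nonneg_entry => //; first exact: skew_unit_so7.
  apply: borelH; rewrite -parabolic_set0; apply/parabolicP.
  apply: root_space_leveled (skew_unit_root_space K i j) _.
  by rewrite levelB lev_ij.
apply: nonneg_part_absorb => //; first exact: skew_unit_so7.
apply: borelH; rewrite -parabolic_set0; apply/parabolicP; split=> [|a b].
  by rewrite so7_lie ?skew_unit_so7.
set E := skew_unit K j i; move=> Eab; rewrite leNgt; apply/negP => ab_lt0.
have levE c d : E c d != 0 -> level set0 (wt c) - level set0 (wt d) = -1.
  by move=> /skew_unit_wt; rewrite -levelB => ->; rewrite levelB -lev_ij opprB.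
have levH c d : H c d != 0 -> level set0 (wt d) <= level set0 (wt c).
  by move/borel_triangular; rewrite levelB subr_ge0.
rewrite levelB in ab_lt0.
have HE c : c != a -> H a c * E c b = 0.
  move=> ca; apply/eqP; apply: contraNT ca; rewrite mulf_eq0 negb_or.
  case/andP => /levH ac /levE cb; apply/eqP/level_wt_inj; apply/eqP; lia.
have EH c : c != b -> E a c * H c b = 0.
  move=> cb; apply/eqP; apply: contraNT cb; rewrite mulf_eq0 negb_or.
  case/andP => /levE ac /levH cb; apply/eqP/level_wt_inj; apply/eqP; lia.
move: Eab; rewrite /lie [_ a b]mxE [X in _ + X]mxE [X in X - _]mxE [X in _ - X]mxE.
rewrite (bigD1 a) //= [X in _ - X](bigD1 b) //= !big1 // !addr0.
rewrite mulrC -mulrBr mulf_eq0 negb_or => /andP[].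
rewrite skew_unitE; case: andP => [[/eqP-> /eqP->]|_]; first by rewrite Hij subrr eqxx.
case: andP => [[/eqP-> /eqP->]|_]; last by rewrite subrr eqxx.
by rewrite !(proj1 (so7_entriesP H)) // Hij subrr eqxx.
Qed.

(** The parabolic contains the root space of - [simple_root k] exactly if [k] is in
    [Pi], so [simple_root_nonnegP] recovers [Pi] from the diagonal of H. *)
Lemma simple_root_levi Pi k :
  (forall X, X \in parabolic K Pi <-> nonneg X) ->
  (k \in Pi) = (H (lo k) (lo k) == H (simple_tgt k) (simple_tgt k)).
Proof.
move=> defp; apply/idP/eqP => [Pik|/simple_root_nonnegP/defp/parabolicP[_ lE]].
  apply/simple_root_nonnegP/defp/parabolicP.
  apply: root_space_leveled (skew_unit_root_space K _ _) _.
  by rewrite -opprB wtB_simple levelN level_simple_root Pik.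
have := lE (simple_tgt k) (lo k); rewrite -opprB wtB_simple levelN level_simple_root.
rewrite skew_unitE !eqxx (negPf (simple_tgt_neq k)) subr0 oner_eq0 => /(_ isT).
by case: (k \in Pi).
Qed.

End ContainsBorel.

(** * The diagonal of g_2 *)

Lemma span_ind (K : fieldType) (V : vectType K) (s : seq V) (P : V -> Prop) :
  P 0 -> (forall u v, P u -> P v -> P (u + v)) ->
  (forall a u, u \in s -> P (a *: u)) -> forall v, v \in <<s>>%VS -> P v.
Proof.
move=> P0 PD Ps v; rewrite -[s]/(tval (in_tuple s)) => /coord_span->.
by apply: (big_ind P) => // i _; apply: Ps; apply: mem_nth.
Qed.

Lemma root_space_diag (K : numFieldType) c (Y : 'M[K]_7) i :
  c != 0 -> Y \in root_space K c -> Y i i = 0.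
Proof.
move=> c0 /root_spaceP[_ cY]; apply/eqP; apply: contraNT c0 => /cY <-.
by rewrite subrr.
Qed.

Lemma roots_neq0 c : c \in Defs.roots -> c != 0.
Proof.
have pos_neq0 d : d \in pos_roots -> d != 0.
  by apply: contraTneq => ->; rewrite mem_pos_roots coords_pos_roots /coords !mxE.
rewrite mem_cat => /orP[/pos_neq0//|/mapP[d /pos_neq0 d0 ->]].
by rewrite oppr_eq0.
Qed.

(** The diagonal comes only from the Cartan subalgebra of g_2, whose generators
    have diagonals (1, -1, 2) and (0, 1, -1) in the first three positions. *)
Lemma g2_span_diag (K : numFieldType) (X : weight -> 'M[K]_7) (Y : 'M[K]_7) :
  {in Defs.roots, forall c, X c \in root_space K c} -> Y \in g2_span X ->
  Y (lo 0) (lo 0) - Y (lo 1) (lo 1) = Y (lo 2) (lo 2).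
Proof.
move=> rootX; apply: (@span_ind K _ (g2_generators X)
  (fun Y => Y (lo 0) (lo 0) - Y (lo 1) (lo 1) = Y (lo 2) (lo 2))).
- by rewrite !mxE subr0.
- by move=> U V U0 V0; rewrite !mxE opprD addrACA U0 V0.
have X0 c i : c \in Defs.roots -> X c i i = 0.
  by move=> rc; apply: root_space_diag (roots_neq0 rc) (rootX c rc).
have Hd k l : Hc K k (lo l) (lo l) = (l == k)%:R.
  by rewrite Hc_diag [LHS]mxE eqxx mulr1n [LHS]mxE wt_lo rmorph_nat.
have DE (A B : 'M[K]_7) i : (A + B) i i = A i i + B i i by rewrite mxE.
have NE (A : 'M[K]_7) i : (- A) i i = - A i i by rewrite mxE.
have MnE (A : 'M[K]_7) n i : (A *+ n) i i = A i i *+ n by rewrite mulmxnE.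
have rootsE c : (c \in Defs.roots) = (coords c \in map coords Defs.roots).
  by rewrite (mem_map coords_inj).
have {}X0 c i : coords c \in map coords Defs.roots -> X c i i = 0.
  by rewrite -rootsE; apply: X0.
rewrite /Defs.roots map_cat coords_pos_roots /= /coords !mxE /= in X0.
have ZE a (A : 'M[K]_7) i : (a *: A) i i = a * A i i by rewrite mxE.
move=> a U genU; rewrite !ZE -mulrBr; congr (a * _).
move: genU; rewrite !inE; move: (Hc K) Hd => D Hd.
case/predU1P => [->|]; first by rewrite !(DE, NE, MnE, Hd) /=; ring.
case/predU1P => [->|]; first by rewrite !(DE, NE, Hd) /=; ring.
by repeat (case/predU1P => [->|]); last move/eqP=> ->;
  rewrite ?(DE, NE) ?X0 ?oppr0 ?addr0 ?subr0 // /coords !mxE.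
Qed.

Lemma mem_listed_sets (Pi : {set 'I_3}) :
  (Pi \in [:: set0; [set 1]; [set 0; 2]; [set: 'I_3]]) = ((0 \in Pi) == (2 \in Pi)).
Proof.
have eqset (A : {set 'I_3}) :
    [&& (0 \in Pi) == (0 \in A), (1 \in Pi) == (1 \in A) & (2 \in Pi) == (2 \in A)] ->
    Pi = A.
  by case/and3P => /eqP P0 /eqP P1 /eqP P2; apply/setP; apply: ord3_ind.
apply/idP/idP.
  by rewrite !inE => /or4P[] /eqP->; rewrite !inE.
case P0: (0 \in Pi); case P2: (2 \in Pi) => // _; case P1: (1 \in Pi).
- by rewrite [Pi](eqset [set: 'I_3]) ?P0 ?P1 ?P2 ?inE ?eqxx ?orbT.
- by rewrite [Pi](eqset [set 0; 2]) ?P0 ?P1 ?P2 ?inE ?eqxx ?orbT.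
- by rewrite [Pi](eqset [set 1]) ?P0 ?P1 ?P2 ?inE ?eqxx ?orbT.
by rewrite [Pi](eqset set0) ?P0 ?P1 ?P2 ?inE ?eqxx ?orbT.
Qed.

Theorem proposition3p7 (R : realType) (X : weight -> 'M[R[i]]_7)
    (hX : g2_normalized X) :
  [/\ injective (@parabolic R[i]),
      parabolic R[i] set0 = borel R[i],
      parabolic R[i] [set: 'I_3] = so7 R[i] &
      forall Pi : {set 'I_3},
        compatible (so7 R[i]) (g2_span X) (parabolic R[i] Pi) <->
        Pi \in [:: set0; [set 1]; [set 0; 2]; [set: 'I_3]]].
Proof.
case: hX => rootX _ _; split.
- apply: (@parabolic_inj _ X) => k; apply: rootX.
  rewrite mem_cat orbC map_f // mem_pos_roots coords_pos_roots /coords.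
  by case: k => [[|[|[|]]] ?] //; rewrite /simple_root (tnth_nth 0) /= !mxE.
- exact: parabolic_set0.
- exact: parabolic_setT.
move=> Pi; rewrite mem_listed_sets; split=> [[H [[Hss _] g2H defp]]|/eqP Pi02].
  have borelH Y : Y \in borel R[i] -> nonneg_part (so7 R[i]) H Y.
    move=> Yb; apply/defp; apply: subvP Yb; apply: addvSl.
  rewrite !(simple_root_levi Hss borelH _ defp).
  have soH : H \in so7 R[i] by case: Hss.
  have H6 : H (simple_tgt 2) (simple_tgt 2) = 0.
    rewrite -{2}(_ : dual (simple_tgt 2) = simple_tgt 2) ?so7_antidiag //.
    by apply: ord_inj; rewrite val_dual val_simple_tgt.
  rewrite H6 -(@g2_span_diag _ X H) //; last by move=> c /rootX[].
  by rewrite (_ : simple_tgt 0 = lo 1) // subr_eq0.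
exists (grading_elt R[i] Pi); split.
- split; first exact: grading_elt_semisimple.
  exact: grading_elt_real.
- exact: grading_elt_g2.
move=> Y; split=> [/parabolicP lY|pY]; first exact/nonneg_gradingP.
exact/parabolicP/nonneg_gradingP.
Qed.
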